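(* Let $G=(V,E)$ be an undirected graph with $m$ edges that is $\gamma$-weakly-regular and a $\phi$-expander. Then every orientation of $G$ that is a local optimum for \textsc{Local-Search} (i.e., no single edge flip strictly decreases $\Phi=\sum_{u\in V}\mathrm{disc}(u)^2$) has $\max_{v\in V}|\mathrm{disc}(v)| = O\big(\frac{\log m}{\phi\gamma}\big)$.
   Context: For an orientation of an undirected graph, $\mathrm{disc}(v)=|\delta_{\mathrm{in}}(v)|-|\delta_{\mathrm{out}}(v)|$ (number of in-edges minus out-edges at $v$); the discrepancy of the orientation is $\max_v|\mathrm{disc}(v)|$. Flipping an edge oriented $u\to v$ to $v\to u$ strictly decreases $\Phi=\sum_u\mathrm{disc}(u)^2$ iff $\mathrm{disc}(v)>\mathrm{disc}(u)+2$. For $S\subseteq V$, $\mathsf{vol}(S)=\sum_{v\in S}\deg(v)$ and $E(S,V\setminus S)$ is the set of edges with exactly one endpoint in $S$. $G$ is a $\phi$-expander if $|E(S,V\setminus S)|\ge\phi\min(\mathsf{vol}(S),\mathsf{vol}(V\setminus S))$ for all $S\subseteq V$. For $\gamma\in[0,1]$, $G$ (with $n$ vertices, $m$ edges) is $\gamma$-weakly-regular if every vertex has degree at least $\gamma\cdot 2m/n$. *)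

(* Defs.v *)
From HB Require Import structures.
From mathcomp Require Import all_boot all_order all_algebra.
From mathcomp Require Import reals exp.

Set Implicit Arguments.
Unset Strict Implicit.
Unset Printing Implicit Defensive.

Import Order.TTheory GRing.Theory Num.Theory.

Local Open Scope ring_scope.

(** Finite loopless undirected graphs. Parallel edges are allowed; the graph is
    simple exactly when [ends] is injective. *)
Record graph := Graph {
  vertex : finType;
  edge : finType;
  ends : edge -> {set vertex};
  card_ends : forall e, #|ends e| = 2%N
}.

Section Degrees.
Variable G : graph.

Definition deg (v : vertex G) : nat := #|[set e : edge G | v \in ends e]|.

Definition vol (S : {set vertex G}) : nat := (\sum_(v in S) deg v)%N.

Definition cut (S : {set vertex G}) : {set edge G} :=
  [set e | #|ends e :&: S| == 1%N].

End Degrees.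

Definition expander (R : realType) (phi : R) (G : graph) : Prop :=
  forall S : {set vertex G},
    phi * Num.min (vol S)%:R (vol (~: S))%:R <= #|cut S|%:R.

Definition weakly_regular (R : realType) (gamma : R) (G : graph) : Prop :=
  forall v : vertex G,
    gamma * (2 * #|edge G|%:R / #|vertex G|%:R) <= (deg v)%:R.

(** [arc e = (u, v)] means that [e] is oriented from [u] to [v]. *)
Record orientation (G : graph) := Orientation {
  arc : edge G -> vertex G * vertex G;
  arcP : forall e, [set (arc e).1; (arc e).2] = ends e
}.

Section Orientations.
Variable G : graph.
Implicit Types (o : orientation G) (e : edge G) (v : vertex G).

Definition in_edges o v : {set edge G} := [set e | (arc o e).2 == v].

Definition out_edges o v : {set edge G} := [set e | (arc o e).1 == v].

Definition disc o v : int := #|in_edges o v|%:Z - #|out_edges o v|%:Z.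

Definition discrepancy o : nat := (\max_(v : vertex G) `|disc o v|)%N.

Definition potential o : int := \sum_(v : vertex G) disc o v ^+ 2.

Definition flip_arc o e0 e : vertex G * vertex G :=
  if e == e0 then ((arc o e).2, (arc o e).1) else arc o e.

Lemma flip_arcP o e0 e :
  [set (flip_arc o e0 e).1; (flip_arc o e0 e).2] = ends e.
Proof. by rewrite /flip_arc; case: eqP => _ /=; [rewrite setUC|]; apply: arcP. Qed.

Definition flip o e0 : orientation G := Orientation (flip_arcP o e0).

Definition local_optimum o : Prop :=
  forall e, ~~ (potential (flip o e) < potential o).

End Orientations.

(* Main.v *)
(** Local optimality means that every arc [u -> v] satisfies
    [disc v <= disc u + 2]. Let [S_t] be the set of vertices of discrepancy at
    least [t >= 0]. The discrepancies in [S_t] sum to the number of edges entering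
    [S_t] minus the number of edges leaving it, so at least half of the cut edges
    enter [S_t], and their tails lie in [S_(t-2)]. By expansion the ratio
    [vol S_t / vol (V \ S_t)] then grows by a factor [1 + phi / 2] from [t] to
    [t - 2]. It lies between [1 / (2m)] and [2m] as long as [1 <= t <= max disc],
    because all degrees are positive and the discrepancies sum to zero, so the
    number of steps is [O(log m / phi)]. Reversing all arcs bounds the negative
    discrepancies. *)
From Pilot Require Import Defs.
From mathcomp Require Import all_boot all_order all_algebra.
From mathcomp Require Import reals exp.
From mathcomp Require Import zify ring lra.
(* Otherwise [arc] denotes [path.arc]. *)
Import Pilot.Defs.

Import Order.TTheory GRing.Theory Num.Theory.

Set Implicit Arguments.
Unset Strict Implicit.
Unset Printing Implicit Defensive.

Local Open Scope ring_scope.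

(** * Volumes and cuts by counting edges *)

Section Volume.
Variable G : graph.
Implicit Types (S A B : {set vertex G}).

Lemma volE S : vol S = (\sum_(e : edge G) #|ends e :&: S|)%N.
Proof.
rewrite /vol /deg.
under eq_bigr do rewrite -sum1dep_card big_mkcond /=.
rewrite exchange_big /=; apply: eq_bigr => e _.
rewrite -sum1_card big_mkcond [RHS]big_mkcond /=.
by apply: eq_bigr => v _; rewrite inE andbC; case: (v \in S); case: (v \in ends e).
Qed.

Lemma vol_setC S : (vol S + vol (~: S) = 2 * #|edge G|)%N.
Proof.
rewrite !volE -big_split /= -sum1_card big_distrr /=.
by apply: eq_bigr => e _; rewrite -setDE cardsID card_ends.
Qed.

Lemma vol_subset A B : A \subset B -> (vol A + vol (B :\: A) = vol B)%N.
Proof.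
by move=> sAB; rewrite /vol (big_setID A (A := B)) /= (setIidPr sAB).
Qed.

Lemma cut_setC S : cut (~: S) = cut S.
Proof.
apply/setP => e; rewrite !inE -setDE.
by move: (cardsID S (ends e)); rewrite card_ends; lia.
Qed.

Lemma cut_le_vol S : (#|cut S| <= vol S)%N.
Proof.
rewrite volE -sum1_card big_mkcond /=.
by apply: leq_sum => e _; rewrite inE; case: eqP => // ->.
Qed.

End Volume.

(** * Discrepancies and boundary edges of a vertex set *)

Section Orientations.
Variables (G : graph) (o : orientation G).

(** Applied to [~: S], this also gives the edges leaving [S]. *)
Definition entering (S : {set vertex G}) : {set edge G} :=
  [set e | ((arc o e).1 \notin S) && ((arc o e).2 \in S)].

Lemma arc_neq e : (arc o e).1 != (arc o e).2.
Proof.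
by have := card_ends e; rewrite -(arcP o) cards2; case: eqP.
Qed.

Lemma card_endsI e (S : {set vertex G}) :
  #|ends e :&: S| = (((arc o e).1 \in S) + ((arc o e).2 \in S))%N.
Proof.
rewrite -sum1_card big_mkcond /= (bigD1 (arc o e).1) //=.
rewrite (bigD1 (arc o e).2) 1?eq_sym ?arc_neq //= big1 ?addn0.
  by rewrite -(arcP o) !inE !eqxx orbT /=; do 2!case: (_ \in S).
by move=> v /andP[/negbTE v1 /negbTE v2]; rewrite -(arcP o) !inE v1 v2.
Qed.

Lemma card_cut S : #|cut S| = (#|entering S| + #|entering (~: S)|)%N.
Proof.
rewrite -!sum1_card !(big_mkcond (fun e => e \in _)) -big_split /=.
apply: eq_bigr => e _; rewrite !inE card_endsI.
by do 2!case: (_ \in S).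
Qed.

Lemma disc_sumE v :
  disc o v = \sum_e (((arc o e).2 == v)%:Z - ((arc o e).1 == v)%:Z).
Proof.
rewrite /disc sumrB; congr (_ - _).
  rewrite -sum1_card -natz natr_sum big_mkcond /=.
  by apply: eq_bigr => e _; rewrite inE; case: eqP.
rewrite -sum1_card -natz natr_sum big_mkcond /=.
by apply: eq_bigr => e _; rewrite inE; case: eqP.
Qed.

(** An edge with both ends in [S] contributes [1 - 1 = 0], so only boundary edges survive. *)
Lemma sum_disc (S : {set vertex G}) :
  \sum_(v in S) disc o v = #|entering S|%:Z - #|entering (~: S)|%:Z.
Proof.
under eq_bigr do rewrite disc_sumE.
rewrite exchange_big /= -!sum1_card !(big_mkcond (fun e => e \in _)) /=.
rewrite -!natz !natr_sum -sumrB.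
have ind w : \sum_(v in S) (w == v)%:Z = (w \in S)%:Z.
  have [wS|wS] := boolP (w \in S).
    rewrite (bigD1 w) //= eqxx big1 ?addr0 // => v /andP[_].
    by rewrite eq_sym => /negbTE->.
  by rewrite big1 // => v vS; case: eqP => // wv; rewrite wv vS in wS.
by apply: eq_bigr => e _; rewrite sumrB !ind !inE; do 2!case: (_ \in S).
Qed.

Lemma sum_disc0 : \sum_v disc o v = 0.
Proof.
have := sum_disc setT; rewrite (eq_bigl xpredT) => [->|v]; last by rewrite inE.
suff e0 S : S = setT \/ S = set0 -> entering S = set0.
  by rewrite setCT (e0 setT (or_introl erefl)) (e0 set0 (or_intror erefl)) subrr.
by case=> ->; apply/setP => e; rewrite !inE ?andbF.
Qed.

End Orientations.

(** * Flips, stability and reversal *)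

Lemma disc_flip (G : graph) (o : orientation G) e v :
  disc (flip o e) v
    = disc o v + 2 * ((arc o e).1 == v)%:Z - 2 * ((arc o e).2 == v)%:Z.
Proof.
rewrite !disc_sumE (bigD1 e) //= [in RHS](bigD1 e) //= /flip_arc eqxx /=.
rewrite (eq_bigr (fun i => ((arc o i).2 == v)%:Z - ((arc o i).1 == v)%:Z)).
  by ring.
by move=> i /negbTE->.
Qed.

(** This consequence of local optimality is what the level argument uses; it passes directly to the
    reversed orientation. *)
Definition stable (G : graph) (o : orientation G) : Prop :=
  forall e, disc o (arc o e).2 <= disc o (arc o e).1 + 2.

Lemma local_optimum_stable (G : graph) (o : orientation G) :
  local_optimum o -> stable o.
Proof.
move=> opt e; have := opt e; rewrite -leNgt /potential.
have n12 := arc_neq o e; have n21 := n12; rewrite eq_sym in n21.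
rewrite (bigD1 (arc o e).1) // (bigD1 (arc o e).2) //=.
rewrite [X in _ <= X](bigD1 (arc o e).1) // (bigD1 (arc o e).2) //=.
rewrite !disc_flip !eqxx (negbTE n12) (negbTE n21).
(* Only the two ends of [e] change. With discrepancies [a] at the tail and [b] at the head, the
   potential grows by [4 * (a - b + 2)]. *)
rewrite [X in _ <= _ + (_ + X)](eq_bigr (fun v => disc o v ^+ 2)); last first.
  move=> v /andP[v1 v2]; rewrite disc_flip.
  by rewrite eq_sym (negbTE v1) eq_sym (negbTE v2) mulr0 addr0 subr0.
by rewrite !addrA lerD2r; nia.
Qed.

Lemma reverse_arcP (G : graph) (o : orientation G) e :
  [set (arc o e).2; (arc o e).1] = ends e.
Proof. by rewrite setUC arcP. Qed.

Definition reverse (G : graph) (o : orientation G) : orientation G :=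
  @Orientation G (fun e => ((arc o e).2, (arc o e).1)) (reverse_arcP o).

Lemma disc_reverse (G : graph) (o : orientation G) v :
  disc (reverse o) v = - disc o v.
Proof. by rewrite /disc opprB. Qed.

Lemma stable_reverse (G : graph) (o : orientation G) :
  stable o -> stable (reverse o).
Proof. by move=> st e; rewrite !disc_reverse /=; move: (st e); lia. Qed.

(* Moving [i] from [y] to [x] improves the ratio [x / y] by [1 + phi / 2]:
   whichever of [x] and [y] is smaller changes by that factor, and the other one
   changes in the favourable direction. *)
Lemma transfer_ratio (R : realFieldType) (phi x y x' y' i : R) :
  0 <= phi -> 0 <= x -> 0 <= y' -> 0 <= i -> x + i <= x' -> y' + i <= y ->
  phi * Num.min x y <= 2 * i ->
  (1 + phi / 2) * (x * y') <= x' * y.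
Proof.
move=> phi0 x0 y'0 i0 hx hy; case: (leP x y) => [xy|yx] hi; have yy : y' <= y by lra.
  have step : (1 + phi / 2) * x <= x' by lra.
  by rewrite mulrA; apply: ler_pM => //; apply: mulr_ge0 => //; lra.
have step : (1 + phi / 2) * y' <= y.
  have : phi * y' <= phi * y by apply: ler_wpM2l.
  by nra.
rewrite mulrCA; apply: ler_pM => //; last by lra.
by apply: mulr_ge0 => //; lra.
Qed.

(** The bound [ln (1 + y) <= y] is applied to the inverse of [1 + x / 2]: there [y = - x / (2 + x)],
    at most [- x / 3] since [x <= 1]. *)
Lemma ln_1Dhalf_ge (R : realType) (x : R) :
  0 <= x -> x <= 1 -> x / 3 <= ln (1 + x / 2).
Proof.
move=> x0 x1; have r0 : 0 < 1 + x / 2 by lra.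
suff : ln ((1 + x / 2)^-1) <= - (x / 3) by rewrite lnV ?posrE // lerN2.
have rV0 : 0 < (1 + x / 2)^-1 by rewrite invr_gt0.
have := @le_ln1Dx R ((1 + x / 2)^-1 - 1) ltac:(lra).
rewrite addrC subrK => /le_trans; apply.
rewrite lerBlDr -[X in X <= _]mul1r ler_pdivrMr //.
have : x * x <= x by rewrite ler_piMr.
by clear; nra.
Qed.

(** * Growth of the volume ratio along the levels *)

Section Levels.
Variables (G : graph) (o : orientation G).
Hypothesis o_stable : stable o.

Definition level (t : int) : {set vertex G} := [set v | t <= disc o v].

(* Stability puts the tail of every edge entering [level t] in [level (t - 2)]. *)
Lemma entering_level (t : int) :
  (vol (level t) + #|entering o (level t)| <= vol (level (t - 2)))%N.
Proof.
have sub : level t \subset level (t - 2).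
  by apply/subsetP => v; rewrite !inE; lia.
rewrite -(vol_subset sub) leq_add2l volE -sum1_card big_mkcond /=; apply: leq_sum => e _.
rewrite (card_endsI o) !inE; have := o_stable e.
by case: ifP => // /andP[]; lia.
Qed.

Lemma cut_level (t : int) : 0 <= t -> (#|cut (level t)| <= 2 * #|entering o (level t)|)%N.
Proof.
move=> t0; rewrite (card_cut o).
suff : 0 <= \sum_(v in level t) disc o v by rewrite sum_disc; lia.
by apply: sumr_ge0 => v; rewrite inE; apply: le_trans.
Qed.

Variables (R : realType) (phi : R).
Hypotheses (phi_gt0 : 0 < phi) (G_exp : expander phi G).

Let f (t : int) : R := (vol (level t))%:R.
Let g (t : int) : R := (vol (~: level t))%:R.

(** Growth of [f / g] is stated cross-multiplied, so no volume has to be nonzero. The complement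
    loses what the level gains, as the two volumes sum to [2m]. *)
Lemma vol_ratio_step (t : int) : 0 <= t ->
  (1 + phi / 2) * (f t * g (t - 2)) <= f (t - 2) * g t.
Proof.
move=> t0; rewrite /f /g.
have hx := entering_level t; have hc := cut_level t0.
have hy : (vol (~: level (t - 2)) + #|entering o (level t)|
             <= vol (~: level t))%N.
  by move: (vol_setC (level t)) (vol_setC (level (t - 2))); lia.
move: hx hy; rewrite -!(ler_nat R) !natrD => hx hy.
move: hc; rewrite -(ler_nat R) natrM => hc.
apply: (transfer_ratio _ _ _ _ hx hy (le_trans (G_exp (level t)) hc)) => //.
exact: ltW.
Qed.

Let r_gt0 : 0 < 1 + phi / 2.
Proof. by rewrite addr_gt0 // divr_gt0. Qed.

Hypothesis deg_gt0 : forall v : vertex G, (0 < deg v)%N.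

Lemma vol_gt0 (S : {set vertex G}) v : v \in S -> (0 < vol S)%N.
Proof. by move=> vS; rewrite /vol (bigD1 v) //= addn_gt0 deg_gt0. Qed.

Lemma vol_levelC_gt0 v (t : int) : 0 < disc o v -> 1 <= t -> (0 < vol (~: level t))%N.
Proof.
move=> dv t1.
have [/existsP[w wt]|/existsPn dpos] := boolP [exists w, disc o w < t].
  by apply: (@vol_gt0 _ w); rewrite !inE -ltNge.
suff : 0 < \sum_w disc o w by rewrite sum_disc0.
rewrite (bigD1 v) //= ltr_wpDr // sumr_ge0 // => w _.
by move: (dpos w); lia.
Qed.

Lemma vol_ratio_iter v k (t : int) : 0 < disc o v -> t <= disc o v -> 1 <= t - 2 * k%:Z ->
  (1 + phi / 2) ^+ k * (f t * g (t - 2 * k%:Z)) <= f (t - 2 * k%:Z) * g t.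
Proof.
move=> dv tv; elim: k => [|k IH] tk; first by rewrite expr0 mul1r mulr0 subr0.
have {}IH := IH ltac:(lia).
have := @vol_ratio_step (t - 2 * k%:Z) ltac:(lia).
have -> : t - 2 * k%:Z - 2 = t - 2 * k.+1%:Z by lia.
have fk : 0 < f (t - 2 * k%:Z).
  by rewrite ltr0n; apply: (@vol_gt0 _ v); rewrite inE; lia.
have gk : 0 < g (t - 2 * k%:Z).
  by rewrite ltr0n; apply: (@vol_levelC_gt0 v); lia.
(* After multiplication by the positive volumes at the middle level, the goal is the product of [IH]
   and [step]. *)
move=> step; rewrite -(ler_pM2l (mulr_gt0 fk gk)).
have -> : f (t - 2 * k%:Z) * g (t - 2 * k%:Z)
    * ((1 + phi / 2) ^+ k.+1 * (f t * g (t - 2 * k.+1%:Z)))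
  = (1 + phi / 2) ^+ k * (f t * g (t - 2 * k%:Z))
    * ((1 + phi / 2) * (f (t - 2 * k%:Z) * g (t - 2 * k.+1%:Z))).
  by rewrite exprS; ring.
have -> : f (t - 2 * k%:Z) * g (t - 2 * k%:Z) * (f (t - 2 * k.+1%:Z) * g t)
  = f (t - 2 * k%:Z) * g t * (f (t - 2 * k.+1%:Z) * g (t - 2 * k%:Z)).
  by ring.
apply: ler_pM => //; rewrite !mulr_ge0 ?exprn_ge0 //; exact: ltW.
Qed.

(** [level 1] and its complement both have positive volume, and a cut has at most as many edges as
    the volume of either side. *)
Lemma expander_le1 v : 0 < disc o v -> phi <= 1.
Proof.
move=> dv; set S := level 1.
have vS : (0 < vol S)%N by apply: (@vol_gt0 _ v); rewrite inE.
have vC : (0 < vol (~: S))%N by apply: (@vol_levelC_gt0 v).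
have min0 : 0 < Num.min (vol S)%:R (vol (~: S))%:R :> R.
  by rewrite lt_min !ltr0n vS.
rewrite -(ler_pM2r min0) mul1r; apply: le_trans (G_exp S) _.
by rewrite le_min !ler_nat cut_le_vol -cut_setC cut_le_vol.
Qed.

Lemma expr_disc_le v k : 2 * k%:Z < disc o v ->
  (1 + phi / 2) ^+ k <= (2 * #|edge G|)%:R ^+ 2.
Proof.
move=> kv; have dv : 0 < disc o v by lia.
have := @vol_ratio_iter v k (disc o v) dv (lexx _) ltac:(lia).
set t := _ - _ => iter.
have fv : 1 <= f (disc o v).
  by rewrite ler1n; apply: (@vol_gt0 _ v); rewrite inE.
have gt : 1 <= g t by rewrite ler1n; apply: (@vol_levelC_gt0 v) => //; lia.
have le_total (S : {set vertex G}) : (vol S <= 2 * #|edge G|)%N by rewrite -(vol_setC S) leq_addr.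
have r0 : 0 <= (1 + phi / 2) ^+ k by rewrite exprn_ge0 // ltW.
apply: le_trans (le_trans _ iter) _.
  by rewrite ler_peMr //; nra.
by rewrite expr2 ler_pM // ler_nat.
Qed.

Lemma disc_le v : (2 <= #|edge G|)%N ->
  (disc o v)%:~R <= 28 * (ln #|edge G|%:R / phi) :> R.
Proof.
move=> m2; set m : R := #|edge G|%:R.
have m2' : 2 <= m by rewrite ler_nat.
have lnhalf : ln (2^-1 : R) <= - 2^-1.
  have := @le_ln1Dx R (- 2^-1) ltac:(lra).
  by have -> : 1 + - 2^-1 = 2^-1 :> R by lra.
have ln2 : 2^-1 <= ln (2 : R).
  by move: lnhalf; rewrite lnV ?posrE //; lra.
have ln2m : ln (2 : R) <= ln m by rewrite ler_ln ?posrE //; lra.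
have [dv|dv] := lerP (disc o v) 0.
  apply: (@le_trans _ _ 0); first by rewrite lerz0.
  by rewrite mulr_ge0 ?divr_ge0 ?(ltW phi_gt0) //; lra.
have phi1 := expander_le1 dv.
(* [k] is the largest number of steps keeping the level positive. *)
pose k := ((`|disc o v|%N).-1)./2.
have kv : 2 * k%:Z < disc o v <= 2 * k%:Z + 2 by rewrite /k; lia.
have /andP[kv1 kv2] := kv.
have pow := expr_disc_le kv1.
have ln_r := ln_1Dhalf_ge (ltW phi_gt0) phi1.
have kln : k%:R * (phi / 3) <= 4 * ln m.
  apply: (@le_trans _ _ (ln ((1 + phi / 2) ^+ k))).
    by rewrite lnXn // -[X in _ <= X]mulr_natl ler_wpM2l.
  (* The factor 4 comes from [2 * ln 2 + 2 * ln m] and [ln 2 <= ln m]. *)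
  apply: (@le_trans _ _ (ln ((2 * m) ^+ 2))).
    rewrite ler_ln ?posrE ?exprn_gt0 //; last by lra.
    by move: pow; rewrite natrM.
  rewrite lnXn; last by lra.
  by rewrite lnM ?posrE; lra.
rewrite mulrA ler_pdivlMr //.
have dk : (disc o v)%:~R <= 2 * k%:R + 2 :> R.
  apply: (@le_trans _ _ (2 * k%:Z + 2)%:~R); first by rewrite ler_int.
  by rewrite intrD intrM.
apply: (@le_trans _ _ ((2 * k%:R + 2) * phi)); first by rewrite ler_pM2r.
(* [kln] gives [2 * k * phi <= 24 * ln m], and [2 * phi <= 2 <= 4 * ln m] by [phi1] and
   [ln m >= 1 / 2]; hence 28. *)
by nra.
Qed.

End Levels.

(** * Positive degrees and the final bound *)

Lemma weakly_regular_deg_gt0 (R : realType) (gamma : R) (G : graph) :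
  (0 < #|edge G|)%N -> 0 < gamma -> weakly_regular gamma G ->
  forall v : vertex G, (0 < deg v)%N.
Proof.
move=> m0 gamma0 reg v; rewrite -(ltr0n R); apply: lt_le_trans (reg v).
have n0 : (0 < #|vertex G|)%N by apply/card_gt0P; exists v.
by rewrite mulr_gt0 // divr_gt0 ?mulr_gt0 ?ltr0n.
Qed.

Theorem theorem3p3 (R : realType) :
  exists2 C : R, 0 < C &
    forall (G : graph) (gamma phi : R),
      (2 <= #|edge G|)%N ->
      0 < gamma <= 1 ->
      0 < phi ->
      weakly_regular gamma G ->
      expander phi G ->
      forall o : orientation G,
        local_optimum o ->
        (discrepancy o)%:R <= C * (ln #|edge G|%:R / (phi * gamma)).
Proof.
exists 28 => // G gamma phi m2 /andP[gamma0 gamma1] phi0 reg exp o opt.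
have deg0 := weakly_regular_deg_gt0 (ltnW m2) gamma0 reg.
have st := local_optimum_stable opt.
have ln0 : 0 <= ln #|edge G|%:R :> R by rewrite ln_ge0 // ler1n ltnW.
apply: (@le_trans _ _ (28 * (ln #|edge G|%:R / phi))); last first.
  rewrite ler_pM2l // ler_wpM2l // lef_pV2 ?posrE ?mulr_gt0 //.
  by rewrite ler_piMr // ltW.
rewrite /discrepancy; elim/big_ind: _ => [|a b ha hb|v _].
- by rewrite mulr_ge0 // divr_ge0 // ltW.
- by case: (leqP a b).
have up := disc_le st phi0 exp deg0 v m2.
have := disc_le (stable_reverse st) phi0 exp deg0 v m2.
rewrite disc_reverse rmorphN /= => low.
rewrite -[X in X <= _]/((`|disc o v|%N)%:Z%:~R) abszE intr_norm.
by rewrite ler_norml up lerNl low.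
Qed.
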